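(* Suppose $p_1,\ldots,p_n$ are conditionally valid (A1) and mutually independent (A2), and the combining function $f$ satisfies monotonicity and symmetry (A0). Let $\tilde\ell^+_\alpha(\mathcal I)$ and $\tilde\ell^-_\alpha(\mathcal I)$ be the lower bounds for $n^+(\mathcal I)$ and $n^-(\mathcal I)+n^0(\mathcal I)$ given by the partitioning procedure with the adaptive local tests $\psi_{\mathcal K}$. Then: (i) for any nonempty $\mathcal I\subseteq[n]$, $\tilde\ell^+_\alpha(\mathcal I)$ and $\tilde\ell^-_\alpha(\mathcal I)$ can be computed with at most $\mathcal O\big(|\mathcal I|^2\cdot\max(1,|\mathcal I^c|^2)\big)$ computation; (ii) for every $\theta\in\mathbb{R}^n$, $$\mathbb{P}_\theta\Big(n^+(\mathcal I)\ge\tilde\ell_\alpha^+(\mathcal I)\ \text{and}\ n^-(\mathcal I)+n^0(\mathcal I)\ge\tilde\ell_\alpha^-(\mathcal I)\ \text{for all }\mathcal I\subseteq[n]\ \Big|\ \mathcal S\Big)\ge 1-\alpha;$$ (iii) for every $\theta\in\mathbb{R}^n$, $$\mathbb{P}_\theta\Big(n^+(\mathcal I)\ge\tilde\ell_\alpha^+(\mathcal I)\ \text{and}\ n^-(\mathcal I)+n^0(\mathcal I)\ge\tilde\ell_\alpha^-(\mathcal I)\ \text{for all }\mathcal I\subseteq[n]\Big)\ge 1-(1-2^{-n})\alpha>1-\alpha .$$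
   Context: Setting. $[n]=\{1,\ldots,n\}$, $\alpha\in(0,1)$, $\mathcal I^c=[n]\setminus\mathcal I$. $\{\mathbb{P}_\theta:\theta\in\mathbb{R}^n\}$ is a family of probability laws for a random vector $(p_1,\ldots,p_n)\in[0,1]^n$; $q_i=1-p_i$. Here $p_i$ is a valid $p$-value for $H_i^-:\theta_i\le 0$ and $q_i$ a valid $p$-value for $H_i^+:\theta_i\ge 0$, i.e. for all $x\in[0,1]$, $\mathbb{P}_\theta(p_i\le x)\le x$ if $\theta_i\le 0$ and $\mathbb{P}_\theta(q_i\le x)\le x$ if $\theta_i\ge 0$. For $\mathcal I\subseteq[n]$, $n^+(\mathcal I)$, $n^-(\mathcal I)$, $n^0(\mathcal I)$ are the numbers of $i\in\mathcal I$ with $\theta_i>0$, $\theta_i<0$, $\theta_i=0$. (A0) For every $d$, $f(x_1,\ldots,x_d)\le f(x'_1,\ldots,x'_d)$ whenever $x_i\le x'_i$ for all $i$, and $f(x_1,\ldots,x_d)=f(x_{j_1},\ldots,x_{j_d})$ for every permutation $(j_1,\ldots,j_d)$ of $(1,\ldots,d)$. (A1) Conditional validity: for every $i$ and $x\in[0,1]$, $\mathbb{P}_\theta(2p_i\le x\mid p_i\le 1/2)\le x$ for all $\theta$ with $\theta_i\le 0$, and $\mathbb{P}_\theta(2q_i\le x\mid p_i>1/2)\le x$ for all $\theta$ with $\theta_i\ge 0$ (whenever the conditioning event has positive probability). (A2) Under every $\mathbb{P}_\theta$, $p_1,\ldots,p_n$ are mutually independent. Combining function. $f$ is a family of measurable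 functions $f:[0,1]^d\to[0,1]$, $d\ge 1$, valid for independent $p$-values: if $x_1,\ldots,x_d$ are independent with $\mathbb{P}(x_i\le t)\le t$ for all $t\in[0,1]$, then $\mathbb{P}(f(x_1,\ldots,x_d)\le t)\le t$ for all $t\in[0,1]$. Convention: $f(\emptyset)=1$. Selection. $\mathcal S^-=\{i:p_i\le 1/2\}$, $\mathcal S^+=\{i:p_i>1/2\}$; the vector of signs $\mathcal S\in\{-1,1\}^n$ has $i$th coordinate $-1$ if $p_i\le 1/2$ and $+1$ otherwise. Statements conditional on $\mathcal S$ mean: conditional on $\mathcal S=s$ for every $s$ of positive probability. Adaptive local tests. For $\mathcal K\subseteq[n]$ (representing the orthant hypothesis $\theta_i>0$ for $i\in\mathcal K$, $\theta_j\le 0$ for $j\notin\mathcal K$), $\psi_{\mathcal K}=\mathbf 1\{f(\{2p_i,i\in\mathcal K^c\cap\mathcal S^-\}\cup\{2q_j,j\in\mathcal K\cap\mathcal S^+\})\le\alpha\}$ (collections taken with multiplicity). Partitioning bounds. $\psi_v(\mathcal I)=\min\{\psi_{\mathcal K}:\mathcal K\subseteq[n],|\mathcal K\cap\mathcal I|=v\}$, $\mathcal N^+(\mathcal I)_\alpha=\{v\in\{0,\ldots,|\mathcal I|\}:\psi_v(\mathcal I)=0\}$, $\tilde\ell_\alpha^+(\mathcal I)=\min\mathcal N^+(\mathcal I)_\alpha$, $\tilde\ell_\alpha^-(\mathcal I)=|\mathcal I|-\max\mathcal N^+(\mathcal I)_\alpha$. Computation is counted as the number of evaluations of the combining function $f$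 (after sorting the $p$-values); the constant in $\mathcal O$ is absolute. *)

(* Defs.v *)
From HB Require Import structures.
From mathcomp Require Import all_boot all_order all_fingroup all_algebra.
From mathcomp Require Import all_classical all_reals all_analysis.

Set Implicit Arguments.
Unset Strict Implicit.
Unset Printing Implicit Defensive.

Import Order.TTheory GRing.Theory Num.Theory.

Local Open Scope classical_set_scope.
Local Open Scope ring_scope.

Definition in01 {R : realType} (x : R) : Prop := 0 <= x <= 1.

(** * Probability *)

Section Probability.
Context {R : realType} {disp : measure_display} {T : measurableType disp}.
Implicit Types (P : probability T R) (A B : set T).

(* Only meaningful when [0 < P B]; it is used only under that hypothesis. *)
Definition cond_prob P A B : R := fine (P (A `&` B)) / fine (P B).

Definition mutually_independent P (n : nat) (X : 'I_n -> {mfun T >-> R}) : Prop :=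
  forall (J : {set 'I_n}) (B : 'I_n -> set R),
    (forall i, measurable (B i)) ->
    P (\bigcap_(i in [set` J]) (X i @^-1` B i)) =
      (\prod_(i in J) P (X i @^-1` B i))%E.

End Probability.

(** * Combining functions *)

(* The family of functions f : [0,1]^d -> [0,1] is encoded as one function on
   finite sequences: the d-ary member is its restriction to sequences of length
   d, and the values outside the cubes [0,1]^d are left unconstrained. *)

Section Combining.
Context {R : realType}.
Implicit Types f : seq R -> R.

Definition cube (d : nat) : set (d.-tuple R) :=
  [set x : d.-tuple R | forall i, in01 (tnth x i)].

Arguments cube : clear implicits.

Definition valid_combining f : Prop :=
  forall (d : nat) (disp : measure_display) (T : measurableType disp)
    (P : probability T R) (x : 'I_d -> {mfun T >-> R}),
  (0 < d)%N ->
  (forall i w, in01 (x i w)) ->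
  mutually_independent P x ->
  (forall i (t : R), in01 t -> (P [set w | x i w <= t]%R <= t%:E)%E) ->
  forall t : R, in01 t ->
    (P [set w | f [tuple x i w | i < d] <= t]%R <= t%:E)%E.

Definition combining_function f : Prop :=
  [/\ forall (d : nat) (x : d.-tuple R), (0 < d)%N -> cube d x -> in01 (f x),
      forall d : nat, (0 < d)%N ->
        measurable_fun (cube d) (fun x : d.-tuple R => f x),
      valid_combining f
    & f [::] = 1].

Definition monotone_combining f : Prop :=
  forall (d : nat) (x y : d.-tuple R), cube d x -> cube d y ->
    (forall i, tnth x i <= tnth y i) -> f x <= f y.

Definition symmetric_combining f : Prop :=
  forall (d : nat) (x : d.-tuple R) (s : 'S_d), cube d x ->
    f [tuple tnth x (s i) | i < d] = f x.

Definition A0 f : Prop := monotone_combining f /\ symmetric_combining f.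

End Combining.

(** * Adaptive local tests and partitioning bounds *)

Lemma bigminn_le (J : eqType) (r : seq J) (Q : pred J) (F : J -> nat) x j :
  j \in r -> Q j -> (\big[minn/x]_(i <- r | Q i) F i <= F j)%N.
Proof.
elim: r => // a r IHr; rewrite inE big_cons => /predU1P[<-|jr] Qj.
  by rewrite Qj geq_minl.
by case: ifP => _; [apply: leq_trans (geq_minr _ _) _|]; exact: IHr.
Qed.

Section Partitioning.
Context {R : realType} {n : nat}.
Implicit Types (f : seq R -> R) (alpha : R) (p : 'I_n -> R) (K I : {set 'I_n}).

Definition Sminus p : {set 'I_n} := [set i | p i <= 2^-1]%SET.
Definition Splus p : {set 'I_n} := [set i | p i > 2^-1]%SET.

Definition signs p : {ffun 'I_n -> int} :=
  [ffun i => if p i <= 2^-1 then (-1)%Z else 1%Z].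

Definition selected_pvalues p K : seq R :=
  [seq 2 * p i | i in ~: K :&: Sminus p] ++
  [seq 2 * (1 - p j) | j in K :&: Splus p].

(* The indicator takes its values in {0, 1} : nat. *)
Definition psi f alpha p K : nat := (f (selected_pvalues p K) <= alpha)%R.

(* The index set of the minimum is nonempty when [v <= #|I|], so the default
   value 1 never matters there. *)
Definition psi_count f alpha p I (v : nat) : nat :=
  \big[minn/1%N]_(K : {set 'I_n} | #|K :&: I| == v) psi f alpha p K.

Definition Nplus f alpha p I : {set 'I_#|I|.+1} :=
  [set v : 'I_#|I|.+1 | psi_count f alpha p I v == 0%N]%SET.

(* [Nplus] is nonempty, see [Sminus_in_Nplus], and its elements are at most
   [#|I|]; hence the default values [#|I|] and 0 do not affect these. *)
Definition ell_plus f alpha p I : nat :=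
  \big[minn/#|I|]_(v in Nplus f alpha p I) (v : nat).
Definition ell_minus f alpha p I : nat :=
  (#|I| - \max_(v in Nplus f alpha p I) (v : nat))%N.

Lemma Sminus_in_Nplus f alpha p I : f [::] = 1 -> alpha < 1 ->
  inord #|Sminus p :&: I| \in Nplus f alpha p I.
Proof.
move=> f0 a1; rewrite inE inordK ?ltnS ?subset_leq_card ?subsetIr //.
rewrite -leqn0 /psi_count.
have : psi f alpha p (Sminus p) = 0%N.
  have -> : psi f alpha p (Sminus p) = (f [::] <= alpha)%R.
    rewrite /psi /selected_pvalues !(eq_image (B := pred0) _ (frefl _)).
    - by rewrite /image_mem !enum0.
    - by move=> i; rewrite !inE ltNge andbN.
    - by move=> i; rewrite !inE andNb.
  by rewrite f0 leNgt a1.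
move=> psi0; rewrite -[X in (_ <= X)%N]psi0.
by apply: bigminn_le; rewrite ?mem_index_enum.
Qed.

Definition n_plus (theta : 'I_n -> R) I : nat := #|[pred i in I | 0 < theta i]|.
Definition n_minus (theta : 'I_n -> R) I : nat := #|[pred i in I | theta i < 0]|.
Definition n_zero (theta : 'I_n -> R) I : nat := #|[pred i in I | theta i == 0]|.

Definition bounds_hold f alpha (theta : 'I_n -> R) p : Prop :=
  forall I : {set 'I_n},
    (ell_plus f alpha p I <= n_plus theta I)%N /\
    (ell_minus f alpha p I <= n_minus theta I + n_zero theta I)%N.

End Partitioning.

(** * Counting evaluations of the combining function *)

(* A computation that has access to f only through evaluations: it is built
   without knowing f, each query may depend on the answers to the previous ones,
   and all other operations (such as sorting the p-values) are free. *)
Inductive oracle_prog (R X : Type) : Type :=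
| Return of X
| Query of seq R & (R -> oracle_prog R X).

(* The result of the computation and the number of evaluations of f. *)
Fixpoint run (R X : Type) (f : seq R -> R) (c : oracle_prog R X) : X * nat :=
  match c with
  | Return x => (x, 0%N)
  | Query s k => let r := run f (k (f s)) in (r.1, r.2.+1)
  end.

(** * Assumptions on the p-values *)

Section PValues.
Context {R : realType} {disp : measure_display} {T : measurableType disp}.
Context {n : nat}.
Variables (P : ('I_n -> R) -> probability T R) (p : 'I_n -> {mfun T >-> R}).

Definition valid_pvalues : Prop :=
  forall (theta : 'I_n -> R) (i : 'I_n) (x : R), in01 x ->
    (theta i <= 0 -> (P theta [set w | p i w <= x]%R <= x%:E)%E) /\
    (0 <= theta i -> (P theta [set w | 1 - p i w <= x]%R <= x%:E)%E).

Definition A1 : Prop :=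
  forall (theta : 'I_n -> R) (i : 'I_n) (x : R), in01 x ->
    (theta i <= 0 ->
       let B := [set w | p i w <= 2^-1] in
       (0 < P theta B)%E ->
       cond_prob (P theta) [set w | 2 * p i w <= x] B <= x) /\
    (0 <= theta i ->
       let B := [set w | p i w > 2^-1] in
       (0 < P theta B)%E ->
       cond_prob (P theta) [set w | 2 * (1 - p i w) <= x] B <= x).

Definition A2 : Prop :=
  forall theta : 'I_n -> R, mutually_independent (P theta) p.

End PValues.

(* Main.v *)
(* Computation. Whether v belongs to N^+(I) depends on the largest value of f over
   the collections selected by the K with |K :&: I| = v. The indices selected by
   K form the symmetric difference U of K and S^-, and |K :&: I| depends on U only
   through its cardinalities in the four cells cut out by I and S^-. By
   monotonicity and symmetry, for given cardinalities the value of f is largest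
   when U takes the largest folded p-values of each cell, so that at most
   (|I|+1)^2 (|I^c|+1)^2 evaluations suffice.

   Coverage. Let K be the true orthant. All bounds hold as soon as psi_K = 0.
   Given the signs, the p-values stay independent, and those selected by K are
   conditionally valid, so that psi_K = 1 has conditional probability at most
   alpha. When the signs are exactly those of the true orthant nothing is selected
   and psi_K = 0; this has probability at least 2^-n, whence the factor 1 - 2^-n. *)

Require Import Defs.
From HB Require Import structures.
From mathcomp Require Import all_boot all_order all_fingroup all_algebra.
From mathcomp Require Import zify lra.
From mathcomp Require Import all_classical all_reals all_analysis.

Set Implicit Arguments.
Unset Strict Implicit.
Unset Printing Implicit Defensive.

Import Order.TTheory GRing.Theory Num.Theory.

Local Open Scope classical_set_scope.
Local Open Scope ring_scope.

(** * Comparison of finite collections through their upper tails *)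

Section Domination.
Context {R : realType}.
Implicit Types (s t : seq R) (f : seq R -> R).

(** Tail counts ignore the order of the entries and add up over disjoint cells, so this comparison
    can be proved cell by cell. *)
Definition dominated s t : Prop :=
  size s = size t /\
  forall x, (count (fun y => (x < y)%R) s <= count (fun y => (x < y)%R) t)%N.

Lemma dominated_perm s s' t t' :
  perm_eq s s' -> perm_eq t t' -> dominated s' t' -> dominated s t.
Proof.
move=> ss' tt' [st ct]; split; first by rewrite (perm_size ss') (perm_size tt').
by move=> x; rewrite (seq.permP ss') (seq.permP tt').
Qed.

(** If the [i]th entry of [t] were below that of [s], then at most [size t - i.+1] entries of [t]
    but at least [size s - i] entries of [s] would exceed it, against domination. *)
Lemma nth_le_of_dominated s t : sorted <=%R s -> sorted <=%R t ->
  dominated s t -> forall i, (i < size s)%N -> nth 0 s i <= nth 0 t i.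
Proof.
move=> ss st [st_size cst] i i_s; rewrite leNgt; apply/negP => lt_ts.
have := cst (nth 0 t i); apply/negP; rewrite -ltnNge.
set a := nth 0 t i in lt_ts *.
rewrite -(cat_take_drop i.+1 t) count_cat.
rewrite [X in (X + _ < _)%N](_ : _ = 0%N); last first.
  apply/eqP; rewrite -leqn0 leqNgt -has_count; apply/hasPn => y.
  move=> /(nthP 0)[j]; rewrite size_take_min ltn_min => /andP[ji jt].
  rewrite nth_take// => <-; rewrite -leNgt.
  by apply: (sorted_leq_nth le_trans lexx 0 st) => //; rewrite inE -?st_size.
rewrite add0n; apply: (@leq_ltn_trans (size t - i.+1)%N).
  by rewrite -size_drop count_size.
apply: (@leq_trans (size s - i)%N).
  by rewrite -st_size subnS prednK// subn_gt0.
rewrite -[in leqRHS](cat_take_drop i s) count_cat.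
apply: leq_trans (leq_addl _ _).
rewrite -size_drop leq_eqVlt; apply/orP; left.
rewrite eq_sym -all_count; apply/allP => b /(nthP 0)[j].
rewrite size_drop => js <-; rewrite nth_drop.
apply: lt_le_trans lt_ts _.
by apply: (sorted_leq_nth le_trans lexx 0 ss); rewrite ?inE ?leq_addr// -ltn_subRL.
Qed.

Lemma symmetric_combining_perm f s t : symmetric_combining f ->
  (forall x, x \in s -> in01 x) -> perm_eq s t -> f s = f t.
Proof.
move=> fS s01; rewrite perm_sym => pst.
have /tuple_permP[sg ->] : perm_eq t (in_tuple s) by [].
symmetry; apply: (fS _ (in_tuple s)) => i.
exact/s01/mem_tnth.
Qed.

(** Symmetry allows both collections to be sorted; domination then becomes an entrywise inequality,
    to which monotonicity applies. *)
Lemma A0_dominated f s t : A0 f ->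
  (forall x, x \in s -> in01 x) -> (forall x, x \in t -> in01 x) ->
  dominated s t -> f s <= f t.
Proof.
move=> [fM fS] s01 t01 dst.
have ps : perm_eq s (sort <=%R s) by rewrite perm_sym perm_sort.
have pt : perm_eq t (sort <=%R t) by rewrite perm_sym perm_sort.
rewrite (symmetric_combining_perm fS s01 ps) (symmetric_combining_perm fS t01 pt).
have : dominated (sort <=%R s) (sort <=%R t).
  by apply: dominated_perm dst; rewrite perm_sort.
have := sort_le_sorted s; have := sort_le_sorted t.
have {s01 ps} : forall x, x \in sort <=%R s -> in01 x.
  by move=> x; rewrite mem_sort; apply: s01.
have {t01 pt} : forall x, x \in sort <=%R t -> in01 x.
  by move=> x; rewrite mem_sort; apply: t01.
move: (sort _ s) (sort _ t) => {dst}{}s {}t t01 s01 st ss dst.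
have := nth_le_of_dominated ss st dst.
case: dst => e _ le_st.
have et : size t == size s by rewrite e.
rewrite -[t]/(tval (Tuple et)) -[s]/(tval (in_tuple s)).
apply: fM => i; rewrite ?(tnth_nth 0)/=; last exact: le_st.
  by apply/s01/mem_nth.
by apply/t01/mem_nth; rewrite -e.
Qed.

End Domination.

(** * Largest elements of a finite set, globally and cell by cell *)

Section TopSets.
Context {R : realType} {T : finType}.
Implicit Types (g : T -> R) (A B : {set T}) (k : nat).

Definition top g A k : {set T} :=
  [set i in take k (sort (fun i j => g j <= g i) (enum A))]%SET.

Lemma sub_top g A k : (top g A k \subset A)%SET.
Proof.
by apply/fintype.subsetP => i; rewrite inE => /mem_take; rewrite mem_sort mem_enum.
Qed.

Lemma card_top g A k : (k <= #|A|)%N -> #|top g A k| = k.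
Proof.
move=> kA; rewrite cardsE (card_uniqP _); last first.
  by rewrite take_uniq// sort_uniq enum_uniq.
by rewrite size_take_min size_sort -cardE; apply/minn_idPl.
Qed.

Lemma top_max g A k i j : i \in top g A k -> j \in A -> j \notin top g A k ->
  g j <= g i.
Proof.
rewrite !inE => ik jA jk.
set r := fun i j => g j <= g i in ik jk *.
have tot : total r by move=> ? ?; exact: le_total.
have tr : transitive r by move=> y x z xy yz; exact: le_trans yz xy.
have := sort_sorted tot (enum A); rewrite (sorted_pairwise tr).
rewrite -(cat_take_drop k (sort r (enum A))) pairwise_cat.
move=> /andP[/allrelP rr _]; apply: rr => //.
have : j \in sort r (enum A) by rewrite mem_sort mem_enum.
by rewrite -{1}(cat_take_drop k (sort r (enum A))) mem_cat (negPf jk).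
Qed.

(** Either some element of [A] left out of the top set exceeds [x], and then the whole top set does,
    with its [#|B|] elements; or every element of [A] above [x], hence every such element of [B],
    lies in the top set. *)
Lemma top_count g A B (x : R) : (B \subset A)%SET ->
  (#|[set i in B | (x < g i)%R]%SET| <=
   #|[set i in top g A #|B| | (x < g i)%R]%SET|)%N.
Proof.
move=> BA; set U := top _ _ _.
have cU : #|U| = #|B| by rewrite card_top// subset_leq_card.
have [/existsP[j /and3P[jA jU xj]]|/existsPn noj] :=
    boolP [exists j, [&& j \in A, j \notin U & (x < g j)%R]].
  have -> : [set i in U | (x < g i)%R]%SET = U.
    apply/setP => i; rewrite inE; case: (boolP (i \in U)) => //= iU.
    exact: lt_le_trans xj (top_max iU jA jU).
  by rewrite cU; apply/subset_leq_card/fintype.subsetP => i; rewrite inE => /andP[].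
apply/subset_leq_card/fintype.subsetP => i; rewrite !inE => /andP[iB xi].
rewrite xi andbT.
have := noj i; rewrite xi (fintype.subsetP BA _ iB)/= andbT negbK.
by rewrite inE.
Qed.

End TopSets.

Section CellwiseTop.
Context {R : realType} {T J : finType}.
Implicit Types (g : T -> R) (c : T -> J) (kappa : J -> nat) (U : {set T}).

Definition cell c (j : J) : {set T} := [set i | c i == j]%SET.

(** Here [c] labels the cells and [kappa] is the quota to be taken from each. *)
Definition cell_top g c kappa : {set T} :=
  [set i | i \in top g (cell c (c i)) (kappa (c i))]%SET.

Definition cell_card c U (j : J) : nat := #|U :&: cell c j|.

Lemma cell_topI g c kappa j :
  (cell_top g c kappa :&: cell c j = top g (cell c j) (kappa j))%SET.
Proof.
apply/setP => i; rewrite finset.in_setI inE [i \in cell c j]inE.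
case: eqP => [->|/eqP ij]; first by rewrite andbT.
rewrite andbF; apply/esym/negbTE; apply: contra ij.
by move=> /(fintype.subsetP (sub_top _ _ _)); rewrite inE.
Qed.

Lemma cell_card_top g c U j :
  cell_card c (cell_top g c (cell_card c U)) j = cell_card c U j.
Proof.
by rewrite /cell_card cell_topI card_top// subset_leq_card// finset.subsetIr.
Qed.

Lemma card_cells c U : #|U| = (\sum_j cell_card c U j)%N.
Proof.
rewrite -sum1_card (partition_big c xpredT)//=; apply: eq_bigr => j _.
rewrite sum1_card; apply: eq_card => i; rewrite !inE.
by rewrite unfold_in /=.
Qed.

(** Both the sizes and the tail counts are sums over the cells, so [top_count] is applied in each
    cell. *)
Lemma cell_top_dominated g c U :
  dominated [seq g i | i in U] [seq g i | i in cell_top g c (cell_card c U)].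
Proof.
split.
  rewrite !size_image (card_cells c) [RHS](card_cells c).
  by apply: eq_bigr => j _; rewrite cell_card_top.
move=> x.
have cnt (V : {set T}) : count (fun y : R => x < y) [seq g i | i in V] =
    #|[set i in V | (x < g i)%R]%SET|.
  rewrite count_map -size_filter cardE; congr size.
  rewrite /enum_mem -filter_predI.
  by apply: eq_filter => i; rewrite !inE andbC.
rewrite !cnt (card_cells c) [leqRHS](card_cells c).
apply: leq_sum => j _; rewrite /cell_card.
have E (V : {set T}) : ([set i in V | (x < g i)%R] :&: cell c j =
    [set i in V :&: cell c j | (x < g i)%R])%SET.
  by apply/setP => i; rewrite !inE; do ![case: (_ == _)|case: (_ \in _)|case: (_ < _)].
by rewrite !E cell_topI top_count// finset.subsetIr.
Qed.

End CellwiseTop.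

(** * Reduction to polynomially many candidate orthants *)

Section Candidates.
Context {R : realType} {n : nat}.
Implicit Types (f : seq R -> R) (alpha : R) (p : 'I_n -> R) (K I S U : {set 'I_n}).

(** Twice the smaller of the two one-sided p-values. It does not involve [K], so the choice of [K]
    only decides which indices are selected. *)
Definition folded p (i : 'I_n) : R :=
  if p i <= 2^-1 then 2 * p i else 2 * (1 - p i).

(** Symmetric difference with [S]. For [S = Sminus p] it exchanges an orthant [K] and the set of
    indices that [K] selects. *)
Definition flip S K : {set 'I_n} := [set i | (i \in K) (+) (i \in S)]%SET.

Lemma flipK S : involutive (flip S).
Proof. by move=> K; apply/setP => i; rewrite !inE addbK. Qed.

Lemma folded_in01 p i : in01 (p i) -> in01 (folded p i).
Proof.
move=> /andP[p0 p1]; rewrite /folded /in01; case: ifPn => [ple|].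
  by apply/andP; split; lra.
by rewrite -ltNge => plt; apply/andP; split; lra.
Qed.

Lemma selected_pvalues_perm p K :
  perm_eq (selected_pvalues p K) [seq folded p i | i in flip (Sminus p) K].
Proof.
have -> : selected_pvalues p K =
    map (folded p) (enum (~: K :&: Sminus p) ++ enum (K :&: Splus p)).
  rewrite map_cat; congr (_ ++ _); apply/eq_in_map => i.
    by rewrite mem_enum !inE /folded => /andP[_ ->].
  by rewrite mem_enum !inE /folded leNgt => /andP[_ ->].
apply/perm_map/uniq_perm; rewrite ?enum_uniq// ?cat_uniq ?enum_uniq.
  rewrite andbT/=; apply/hasPn => i; rewrite /= !mem_enum !inE.
  by case/andP => ->.
move=> i; rewrite mem_cat !mem_enum !inE ltNge.
by case: (i \in K); case: (p i <= _).
Qed.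

Lemma selected_pvalues_in01 p K : (forall i, in01 (p i)) ->
  forall x, x \in selected_pvalues p K -> in01 x.
Proof.
move=> p01 x; rewrite (perm_mem (selected_pvalues_perm p K)).
by move=> /fintype.imageP[i _ ->]; exact: folded_in01.
Qed.

Definition quadrant S I (i : 'I_n) : bool * bool := (i \in I, i \in S).

(** Within [I], flipping complements [U] on [S] and leaves it unchanged off [S]. Hence the size of
    the flipped set inside [I] is a function of the cell counts of [U] alone. *)
Lemma cell_card_flip S I U j :
  cell_card (quadrant S I) (flip S U :&: I)%SET j =
  if j.1 then
    if j.2 then (#|cell (quadrant S I) j| - cell_card (quadrant S I) U j)%N
    else cell_card (quadrant S I) U j
  else 0%N.
Proof.
case: j => [[] b]; rewrite /cell_card/=; last first.
  apply/eqP; rewrite cards_eq0; apply/eqP/setP => i; rewrite !inE xpair_eqE.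
  by case: (i \in I); rewrite ?andbF.
case: b.
  rewrite [(U :&: _)%SET]finset.setIC -cardsD; apply: eq_card => i.
  rewrite !inE xpair_eqE.
  by case: (i \in I); case: (i \in S); case: (i \in U).
apply: eq_card => i; rewrite !inE xpair_eqE.
by case: (i \in I); case: (i \in S); case: (i \in U).
Qed.

Definition quad_counts (m k : nat)
    (x : 'I_m.+1 * 'I_m.+1 * 'I_k.+1 * 'I_k.+1) (j : bool * bool) : nat :=
  if j.1 then if j.2 then x.1.1.1 : nat else x.1.1.2
  else if j.2 then x.1.2 : nat else x.2.

Definition candidate p I x : {set 'I_n} :=
  flip (Sminus p)
    (cell_top (folded p) (quadrant (Sminus p) I) (@quad_counts #|I| #|~: I| x)).

(** All quadruples of counts are listed, even those exceeding the size of a cell: [take] truncates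
    them, and the result is still an orthant, so nothing false can enter. *)
Definition candidates p I : seq {set 'I_n} := codom (@candidate p I).

Lemma size_candidates p I :
  size (candidates p I) = (#|I|.+1 ^ 2 * #|~: I|.+1 ^ 2)%N.
Proof. by rewrite size_codom !card_prod !card_ord !mulnA. Qed.

(* Replacing, inside each quadrant, the selected p-values by the largest ones
   changes neither their number nor #|K :&: I|. *)
Lemma candidates_dominate p I K :
  exists2 K', K' \in candidates p I &
    #|K' :&: I| = #|K :&: I| /\
    dominated (selected_pvalues p K) (selected_pvalues p K').
Proof.
set S := Sminus p; set c := quadrant S I; set U := flip S K.
pose K' := flip S (cell_top (folded p) c (cell_card c U)).
exists K'.
  pose x : 'I_#|I|.+1 * 'I_#|I|.+1 * 'I_#|~: I|.+1 * 'I_#|~: I|.+1 :=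
    (inord (cell_card c U (true, true)), inord (cell_card c U (true, false)),
     inord (cell_card c U (false, true)), inord (cell_card c U (false, false))).
  have -> : K' = candidate p x; last exact: codom_f.
  congr (flip _ (cell_top _ _ _)); apply/funext => j.
  have leI b : (cell_card c U (true, b) <= #|I|)%N.
    apply/subset_leq_card/fintype.subsetP => i.
    by rewrite !inE xpair_eqE => /and3P[_ /eqP-> _].
  have leIC b : (cell_card c U (false, b) <= #|~: I|)%N.
    apply/subset_leq_card/fintype.subsetP => i.
    by rewrite !inE xpair_eqE => /and3P[_ /eqP-> _].
  by case: j => [[] []]; rewrite /quad_counts/= inordK ?ltnS.
split.
  rewrite -[K in RHS](flipK S) (card_cells c) [RHS](card_cells c).
  by apply: eq_bigr => j _; rewrite !cell_card_flip cell_card_top.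
apply: (dominated_perm (selected_pvalues_perm p K) (selected_pvalues_perm p K')).
by rewrite flipK; exact: cell_top_dominated.
Qed.

Lemma psi_count_eq0 f alpha p I v :
  (psi_count f alpha p I v == 0%N) <->
  exists2 K, #|K :&: I| = v & alpha < f (selected_pvalues p K).
Proof.
have psi0 K : (psi f alpha p K == 0%N) = (alpha < f (selected_pvalues p K)).
  by rewrite eqb0 -ltNge.
split=> [|[K <- ltK]].
  (* The default value 1 of the minimum is nonzero, so a zero must come from some [K]. *)
  rewrite /psi_count; elim/big_ind: _ => //.
  - move=> a b ha hb; rewrite /minn; case: ifP => _; [exact: ha | exact: hb].
  - by move=> K /eqP KI; rewrite psi0 => ltK; exists K.
move: ltK; rewrite -psi0 -!leqn0; apply: leq_trans.
by apply: bigminn_le; rewrite ?mem_index_enum.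
Qed.

Definition bounds_of_answers alpha I (r : seq ({set 'I_n} * R)) : nat * nat :=
  let N := [set v : 'I_#|I|.+1 |
             has (fun t => (#|t.1 :&: I| == v) && (alpha < t.2)%R) r]%SET in
  (\big[minn/#|I|]_(v in N) (v : nat), (#|I| - \max_(v in N) (v : nat))%N).

(** An accepted candidate is itself a witness for [Nplus]. Conversely an accepted [K] is dominated
    by a candidate with the same count in [I], whose value of [f] is at least as large and so also
    exceeds [alpha]. *)
Lemma bounds_of_candidates f alpha p I : A0 f -> (forall i, in01 (p i)) ->
  bounds_of_answers alpha I
    [seq (K, f (selected_pvalues p K)) | K <- candidates p I] =
  (ell_plus f alpha p I, ell_minus f alpha p I).
Proof.
move=> fA0 p01; rewrite /bounds_of_answers /ell_plus /ell_minus.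
set N := [set v | _]%SET.
suff -> : N = Nplus f alpha p I by [].
apply/setP => v; rewrite !inE has_map; apply/hasP/idP => [|/psi_count_eq0].
  by move=> [K _ /= /andP[/eqP KI ltK]]; apply/psi_count_eq0; exists K.
move=> [K KI ltK]; have [K' candK' [K'I dom]] := candidates_dominate p I K.
exists K' => //=; rewrite K'I KI eqxx/=; apply: lt_le_trans ltK _.
by apply: A0_dominated fA0 _ _ dom; exact: selected_pvalues_in01.
Qed.

End Candidates.

(** * The program and its number of evaluations *)

Section Oracle.
Context {R X : Type}.

Fixpoint query_all (qs : seq (seq R)) (k : seq R -> X) : oracle_prog R X :=
  if qs is q :: qs' then Query q (fun a => query_all qs' (fun l => k (a :: l)))
  else Return R (k [::]).

Lemma run_query_all (f : seq R -> R) qs k :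
  run f (query_all qs k) = (k (map f qs), size qs).
Proof. by elim: qs k => //= q qs IH k; rewrite IH. Qed.

End Oracle.

(** The queries are fixed in advance by [p] and [I]; the answers enter only the final step. *)
Definition bounds_prog (R : realType) (n : nat) (alpha : R) (I : {set 'I_n})
    (p : 'I_n -> R) : oracle_prog R (nat * nat) :=
  query_all (map (selected_pvalues p) (candidates p I))
    (fun l => bounds_of_answers alpha I (zip (candidates p I) l)).

Lemma bounds_prog_correct (R : realType) (n : nat) (alpha : R) (I : {set 'I_n})
    (p : 'I_n -> R) (f : seq R -> R) : A0 f -> (forall i, in01 (p i)) ->
  run f (bounds_prog alpha I p) =
    ((ell_plus f alpha p I, ell_minus f alpha p I), size (candidates p I)).
Proof.
move=> fA0 p01; rewrite run_query_all size_map -map_comp.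
rewrite -[X in zip X](map_id (candidates p I)) zip_map.
by rewrite -bounds_of_candidates.
Qed.

Lemma candidate_count_bound (m k : nat) : (0 < m)%N ->
  (m.+1 ^ 2 * k.+1 ^ 2 <= 16 * (m ^ 2 * maxn 1 (k ^ 2)))%N.
Proof.
(* One factor 4 for each square: [m + 1 <= 2 * m] as [m] is positive, and
   [k + 1 <= 2 * max(1, k)]. *)
move=> m0; rewrite (_ : 16 = 4 * 4)%N// mulnACA; apply: leq_mul; first by nia.
by case: k => [|k]//; rewrite maxnE; nia.
Qed.

(** * Conditional laws and independence *)

Section Conditioning.
Context {R : realType} {disp : measure_display} {T : measurableType disp}.
Variables (Q : probability T R) (B : set T) (mB : measurable B).

(** A genuine probability, so that the validity of [f], which ranges over all probability spaces,
    applies to it. The second [Q] is only the fallback when [B] is null. *)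
Definition cond_measure : probability T R := mnormalize (mrestr Q mB) Q.

Lemma cond_measureE (A : set T) : measurable (A `&` B) -> (0 < Q B)%E ->
  cond_measure A = (cond_prob Q A B)%:E.
Proof.
move=> mAB QB0; rewrite /cond_measure/= /mnormalize/= /mrestr setTI.
rewrite gt_eqF//= lt_eqF/=; last by rewrite -ge0_fin_numE// fin_num_measure.
by rewrite /cond_prob EFinM fineK// fin_num_measure.
Qed.

End Conditioning.

Section Independence.
Context {R : realType} {disp : measure_display} {T : measurableType disp}.
Implicit Types Q : probability T R.

Lemma measurable_rectangle (n : nat) (X : 'I_n -> {mfun T >-> R})
    (J : {set 'I_n}) (B : 'I_n -> set R) : (forall i, measurable (B i)) ->
  measurable (\bigcap_(i in [set` J]) X i @^-1` B i).
Proof.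
by move=> mB; apply: fin_bigcap_measurable => // i _; exact: measurable_funPTI.
Qed.

Lemma mutually_independent_comp Q (n d : nat) (X : 'I_n -> {mfun T >-> R})
    (iota : 'I_d -> 'I_n) (h : 'I_d -> {mfun R >-> R}) :
  injective iota -> mutually_independent Q X ->
  mutually_independent Q (fun k => (h k \o X (iota k))%FUN : {mfun T >-> R}).
Proof.
move=> iota_inj indX J B mB.
(* Coordinates outside the image of [iota] are left free; injectivity makes the chosen [k]
   unique. *)
pose B' i := if [pick k | iota k == i] is Some k then h k @^-1` B k else setT.
have B'E k : B' (iota k) = h k @^-1` B k.
  rewrite /B'; case: pickP => [l /eqP/iota_inj->//|/(_ k)].
  by rewrite eqxx.
have mB' i : measurable (B' i).
  rewrite /B'; case: pickP => [k _|_]; last exact: measurableT.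
  exact: measurable_funPTI.
have := indX (iota @: J)%SET B' mB'.
rewrite big_imset/=; last by move=> ? ? _ _; exact: iota_inj.
under eq_bigr do rewrite B'E.
move=> <-; congr (Q _); apply/seteqP; split=> w wJ.
  by move=> _ /imsetP[k kJ ->]; rewrite B'E; exact: wJ.
move=> k kJ; have /= := wJ (iota k); rewrite B'E; apply.
exact: imset_f.
Qed.

(** Numerator and denominator are both products over all [n] coordinates; the factors with [i]
    outside [J] coincide and cancel. *)
Lemma independent_cond_prob Q (n : nat) (X : 'I_n -> {mfun T >-> R})
    (D : 'I_n -> set R) (J : {set 'I_n}) (B : 'I_n -> set R) :
  mutually_independent Q X -> (forall i, measurable (D i)) ->
  (forall i, measurable (B i)) ->
  let BD := \bigcap_(i in [set` [set: 'I_n]%SET]) X i @^-1` D i in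
  (0 < Q BD)%E ->
  cond_prob Q (\bigcap_(i in [set` J]) X i @^-1` B i) BD =
    \prod_(i in J) cond_prob Q (X i @^-1` B i) (X i @^-1` D i).
Proof.
move=> indX mD mB BD QBD.
pose B' i := if i \in J then B i `&` D i else D i.
have mB' i : measurable (B' i).
  by rewrite /B'; case: ifP => // _; exact: measurableI.
have fin i A : measurable A -> (Q (X i @^-1` A)) = (fine (Q (X i @^-1` A)))%:E.
  by move=> mA; rewrite fineK// fin_num_measure//; exact: measurable_funPTI.
have BDE : Q BD = (\prod_i fine (Q (X i @^-1` D i)))%:E.
  rewrite /BD indX// -prodEFin; apply: eq_big => [i|i _]; first by rewrite inE.
  exact: fin.
have -> : cond_prob Q (\bigcap_(i in [set` J]) X i @^-1` B i) BD =
    (\prod_i fine (Q (X i @^-1` B' i))) / \prod_i fine (Q (X i @^-1` D i)).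
  rewrite /cond_prob BDE/=; congr (_ / _).
  rewrite (_ : _ `&` _ = \bigcap_(i in [set` [set: 'I_n]%SET]) X i @^-1` B' i).
    rewrite indX// (_ : (\prod_(i in _) _)%E =
      (\prod_i fine (Q (X i @^-1` B' i)))%:E)//.
    rewrite -prodEFin; apply: eq_big => [i|i _]; first by rewrite inE.
    exact: fin.
  apply/seteqP; split=> [w [wB wD] i iT|w wB'].
    by rewrite /B'; case: ifPn => [iJ|_]; [split; [exact: wB|exact: wD]|exact: wD].
  split=> i /= iJ.
    by have := wB' i; rewrite /= inE /B' iJ => /(_ isT)[].
  have := wB' i; rewrite /= inE /B' => /(_ isT).
  by case: ifP => [_ []|].
(* The product over all coordinates is positive, so no factor vanishes. *)
have D0 i : fine (Q (X i @^-1` D i)) != 0.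
  move: QBD; rewrite BDE lte_fin => /lt0r_neq0; rewrite prodf_seq_neq0.
  by move=> /allP/(_ i); rewrite mem_index_enum => /(_ isT).
rewrite -prodf_div [RHS]big_mkcond/=; apply: eq_bigr => i _.
rewrite /B' /cond_prob -preimage_setI.
by case: ifP => // _; rewrite divff.
Qed.

Lemma mutually_independent_cond Q (n : nat) (X : 'I_n -> {mfun T >-> R})
    (D : 'I_n -> set R) (mBD : measurable
      (\bigcap_(i in [set` [set: 'I_n]%SET]) X i @^-1` D i)) :
  mutually_independent Q X -> (forall i, measurable (D i)) ->
  (0 < Q (\bigcap_(i in [set` [set: 'I_n]%SET]) X i @^-1` D i))%E ->
  [/\ mutually_independent (cond_measure Q mBD) X &
    forall i B, measurable B -> cond_measure Q mBD (X i @^-1` B) =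
      (cond_prob Q (X i @^-1` B) (X i @^-1` D i))%:E].
Proof.
move=> indX mD QBD.
have marg i B : measurable B -> cond_measure Q mBD (X i @^-1` B) =
      (cond_prob Q (X i @^-1` B) (X i @^-1` D i))%:E.
  move=> mB; rewrite cond_measureE//; last first.
    by apply: measurableI => //; exact: measurable_funPTI.
  have := independent_cond_prob [set i]%SET indX mD (fun=> mB) QBD.
  rewrite big_set1 => <-; congr ((cond_prob Q _ _)%:E).
  apply/seteqP; split=> [w wB j|w wB]; first by rewrite /= inE => /eqP->.
  by apply: (wB i); rewrite /= inE.
split=> // J B mB.
rewrite cond_measureE//; last first.
  by apply: measurableI => //; exact: measurable_rectangle.
rewrite independent_cond_prob// -prodEFin; apply: eq_bigr => i _.
by rewrite marg.
Qed.

End Independence.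

(** * Finite partitions of the probability space *)

Section FinitePartitions.
Context {R : realType} {disp : measure_display} {T : measurableType disp}.

(** An event decided by finitely many measurable events is a finite union of atoms of the algebra
    they generate. This gives the measurability of the coverage event. *)
Lemma measurable_finite_pattern (J : finType) (A : J -> set T) (E : set T) :
  (forall j, measurable (A j)) ->
  (forall w w', (forall j, A j w <-> A j w') -> E w -> E w') ->
  measurable E.
Proof.
move=> mA hE.
pose pat w : {ffun J -> bool} := [ffun j => `[< A j w >]].
pose G (g : {ffun J -> bool}) :=
  \bigcap_(j in [set: J]) (if g j then A j else ~` A j).
have GP w g : G g w <-> pat w = g.
  split=> [Gw|<- j _].
    apply/ffunP => j; rewrite ffunE; have := Gw j I.
    by case: (g j) => [?|?]; [exact: asboolT|exact: asboolF].
  by rewrite ffunE; case: asboolP.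
have -> : E = \bigcup_(g in pat @` E) G g.
  apply/seteqP; split=> [w Ew|w [_ [w' Ew' <-] /GP ww']].
    by exists (pat w); [exists w|apply/GP].
  apply: hE Ew' => j; have /ffunP/(_ j) := ww'; rewrite !ffunE => h.
  by split=> /asboolP; [rewrite -h|rewrite h] => /asboolP.
apply: fin_bigcup_measurable; first exact: finite_finset.
move=> g _; apply: fin_bigcap_measurable; first exact: finite_finset.
by move=> j _; case: (g j) => //; exact: measurableC.
Qed.

Lemma measure_finite_partition (Q : probability T R) (J : finType)
    (F : J -> set T) (A : set T) : measurable A ->
  (forall j, measurable (F j)) -> trivIset setT F -> \bigcup_j F j = setT ->
  Q A = (\sum_j Q (A `&` F j))%E.
Proof.
move=> mA mF tF cF; rewrite -[A in LHS]setIT -cF setI_bigcupr.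
rewrite measure_fin_bigcup//; last 3 first.
- exact: finite_finset.
- exact: trivIset_setIl.
- by move=> j _; exact: measurableI.
have -> : [set: J] = [set` index_enum J].
  by apply/seteqP; split=> // j _ /=; rewrite mem_index_enum.
by rewrite -fsbig_seq// index_enum_uniq.
Qed.

End FinitePartitions.

(** * Selected p-values on a fixed sign pattern *)

Section ClippedPvalues.
Context {R : realType}.

(* Outside the sign pattern on which it agrees with a doubled p-value, the
   minimum with 1 keeps this function in [0, 1]. *)
Definition clipped (b : bool) (x : R) : R :=
  Num.min 1 (if b then 2 * x else 2 * (1 - x)).

Lemma measurable_clipped b : measurable_fun [set: R] (clipped b).
Proof.
apply: measurable_realfun.measurable_minr => //.
case: b; apply: measurable_realfun.measurable_funM => //.
exact: measurable_realfun.measurable_funB.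
Qed.

HB.instance Definition _ b :=
  isMeasurableFun.Build _ _ _ _ (clipped b) (measurable_clipped b).

Lemma clipped_in01 b x : in01 x -> in01 (clipped b x).
Proof.
move=> /andP[x0 x1]; rewrite /in01 /clipped ge_min lexx andbT le_min ler01/=.
by case: b; lra.
Qed.

Lemma clipped_le b (x t : R) : t < 1 ->
  (clipped b x <= t) = ((if b then 2 * x else 2 * (1 - x)) <= t).
Proof. by move=> t1; rewrite /clipped ge_min leNgt t1. Qed.

Definition sign_region (b : bool) : set R :=
  if b then [set x | x <= 2^-1] else [set x | 2^-1 < x].

Lemma measurable_sign_region b : measurable (sign_region b).
Proof.
by case: b; rewrite /sign_region -?set_itvNyc -?set_itvoy; exact: measurable_itv.
Qed.

Lemma clippedE b x : sign_region b x -> in01 x ->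
  clipped b x = if b then 2 * x else 2 * (1 - x).
Proof.
move=> bx /andP[x0 x1]; apply/min_idPr; move: bx.
by case: b => /= bx; lra.
Qed.

End ClippedPvalues.

Section SelectedIndices.
Context {R : realType} {n : nat}.
Implicit Types (K S : {set 'I_n}) (p : 'I_n -> R).

(** With [S] fixed instead of read off from [p], the number of arguments of [f] is deterministic.
    The order is that of [selected_pvalues]. *)
Definition selected_indices K S : seq 'I_n := enum (~: K :&: S) ++ enum (K :\: S).

Lemma uniq_selected_indices K S : uniq (selected_indices K S).
Proof.
rewrite cat_uniq !enum_uniq andbT/=; apply/hasPn => i.
by rewrite /= !mem_enum !inE => /andP[/negPf->]; rewrite andbF.
Qed.

Lemma mem_selected_indices K S i :
  (i \in selected_indices K S) = ((i \in K) (+) (i \in S)).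
Proof.
by rewrite mem_cat !mem_enum !inE; case: (i \in K); case: (i \in S).
Qed.

Lemma selected_indices_id K : selected_indices K K = [::].
Proof.
case E : (selected_indices K K) => [//|i s].
have := mem_selected_indices K K i; rewrite E inE eqxx.
by case: (i \in K).
Qed.

Lemma selected_pvaluesE p K S : (forall i, in01 (p i)) -> Sminus p = S ->
  selected_pvalues p K =
  [seq clipped (i \in S) (p i) | i <- selected_indices K S].
Proof.
move=> p01 pS; rewrite map_cat; congr (_ ++ _).
  rewrite -pS; apply/eq_in_map => i.
  rewrite mem_enum !inE => /andP[_ iS].
  by rewrite clippedE// iS.
rewrite (_ : K :\: S = K :&: Splus p)%SET.
  apply/eq_in_map => i; rewrite mem_enum -pS !inE => /andP[_ iS].
  by rewrite leNgt iS clippedE.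
by apply/setP => i; rewrite -pS !inE ltNge andbC.
Qed.

End SelectedIndices.

(** * Rejection probability on a sign pattern *)

Section SignPatterns.
Context {R : realType} {disp : measure_display} {T : measurableType disp}.
Context {n : nat} (p : 'I_n -> {mfun T >-> R}).
Implicit Types K S : {set 'I_n}.

Definition pattern_event S : set T := [set w | Sminus (fun i => p i w) = S].

(** The rectangle form is the one to which independence applies. *)
Lemma pattern_eventE S : pattern_event S =
  \bigcap_(i in [set` [set: 'I_n]%SET]) p i @^-1` sign_region (i \in S).
Proof.
apply/seteqP; split=> [w <- i _|w h].
  by rewrite /= inE /sign_region; case: ifPn => //=; rewrite -ltNge.
apply/setP => i; rewrite inE; have := h i; rewrite /= inE => /(_ isT).
by rewrite /sign_region; case: (i \in S) => //= h'; rewrite leNgt h'.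
Qed.

Lemma measurable_pattern_event S : measurable (pattern_event S).
Proof.
rewrite pattern_eventE; apply: measurable_rectangle => i.
exact: measurable_sign_region.
Qed.

Lemma trivIset_pattern_event : trivIset setT pattern_event.
Proof. by move=> S S' _ _ [w [<- <-]]. Qed.

Lemma bigcup_pattern_event : \bigcup_S pattern_event S = setT.
Proof. by apply/seteqP; split=> // w _; exists (Sminus (fun i => p i w)). Qed.

Definition selected_variable K S (k : 'I_(size (selected_indices K S))) :
    {mfun T >-> R} :=
  let i := tnth (in_tuple (selected_indices K S)) k in
  (clipped (i \in S) \o p i)%FUN.

Definition selected_tuple K S (w : T) :
    (size (selected_indices K S)).-tuple R :=
  [tuple selected_variable k w | k < size (selected_indices K S)].

Hypothesis p01 : forall i w, in01 (p i w).

Lemma selected_variable_in01 K S k w : in01 (@selected_variable K S k w).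
Proof. exact: clipped_in01. Qed.

Lemma selected_tupleE K S w : pattern_event S w ->
  selected_pvalues (fun i => p i w) K = selected_tuple K S w.
Proof.
move=> wS; rewrite (selected_pvaluesE _ _ wS)//=.
have e : [seq tnth (in_tuple (selected_indices K S)) k | k <- enum 'I_(_)] =
  selected_indices K S := map_tnth_enum (in_tuple (selected_indices K S)).
rewrite -[in LHS]e -map_comp.
by [].
Qed.

Definition reject (f : seq R -> R) (alpha : R) K : set T :=
  [set w | f (selected_pvalues (fun i => p i w) K) <= alpha].

Lemma measurable_cube d : measurable (@cube R d).
Proof.
rewrite (_ : @cube R d = \bigcap_(i in [set: 'I_d])
    (fun x : d.-tuple R => tnth x i) @^-1` `[0, 1]%classic).
  apply: fin_bigcap_measurable; first exact: finite_finset.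
  move=> i _; rewrite -[X in measurable X]setTI.
  by apply: measurable_tnth => //; exact: measurable_itv.
apply/seteqP; split=> x h i; have := h i; rewrite /in01 /= in_itv/= => hi.
  by move=> _; exact: hi.
exact: hi.
Qed.

Lemma selected_indices_nil_reject f alpha K S : combining_function f -> alpha < 1 ->
  selected_indices K S = [::] -> reject f alpha K `&` pattern_event S = set0.
Proof.
move=> [_ _ _ f0] a1 e; apply/seteqP; split=> // w [/= + wS].
by rewrite /reject/= (selected_pvaluesE _ _ wS)// e /= f0 leNgt a1.
Qed.

(** The number of arguments of [f] is random, so the event is cut along the sign patterns, on each
    of which a single [d]-ary function is used. *)
Lemma measurable_reject f alpha K : combining_function f -> alpha < 1 ->
  measurable (reject f alpha K).
Proof.
move=> fC a1.
rewrite -[reject _ _ _]setIT -bigcup_pattern_event setI_bigcupr.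
apply: fin_bigcup_measurable; first exact: finite_finset.
move=> S _.
case: (posnP (size (selected_indices K S))) => [/size0nil e|d0].
  by rewrite (selected_indices_nil_reject fC a1 e).
case: fC => _ mf _ _.
pose d := size (selected_indices K S).
(* The [d]-ary function is assumed measurable on the cube only; [selected_tuple] always stays in
   it. *)
have -> : reject f alpha K `&` pattern_event S =
    (selected_tuple K S @^-1` (@cube R d `&`
      (fun x : d.-tuple R => f x) @^-1` `]-oo, alpha]%classic)) `&` pattern_event S.
  apply/seteqP; split=> [w [wr wS]|w [[_ wr] wS]]; split=> //.
    split; last by rewrite /= in_itv/= -selected_tupleE.
    by move=> k; rewrite tnth_mktuple; exact: selected_variable_in01.
  by move: wr; rewrite /= in_itv/= -selected_tupleE.
apply: measurableI; last exact: measurable_pattern_event.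
rewrite -[X in measurable X]setTI.
have mt : measurable_fun [set: T] (selected_tuple K S).
  apply/measurable_fun_tnthP => k.
  rewrite (_ : _ \o _ = selected_variable k)//.
  by apply/funext => w /=; rewrite tnth_mktuple.
apply: mt => //; apply: (mf d d0); first exact: measurable_cube.
exact: measurable_itv.
Qed.

(** Under the law conditioned on the pattern, the selected variables are independent and valid, so
    validity of [f] bounds the conditional probability by [alpha]. The product form also covers null
    patterns. *)
Lemma reject_pattern (Q : probability T R) f alpha K S :
  combining_function f -> 0 < alpha < 1 -> mutually_independent Q p ->
  (forall i t, (i \in K) (+) (i \in S) -> in01 t ->
    (0 < Q (p i @^-1` sign_region (i \in S)))%E ->
    cond_prob Q [set w | (if i \in S then 2 * p i w else 2 * (1 - p i w)) <= t]
      (p i @^-1` sign_region (i \in S)) <= t) ->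
  (Q (reject f alpha K `&` pattern_event S) <= alpha%:E * Q (pattern_event S))%E.
Proof.
move=> fC /andP[a0 a1] indp Qp.
have mr := measurable_reject K fC a1.
have mS := measurable_pattern_event S.
have mI : measurable (reject f alpha K `&` pattern_event S) by exact: measurableI.
have [e|Q0] := eqVneq (Q (pattern_event S)) 0.
  by rewrite e mule0 -e; apply: le_measure; rewrite ?inE//; exact: subIsetr.
have {Q0}Qpos : (0 < Q (pattern_event S))%E by rewrite lt0e Q0 measure_ge0.
case: (posnP (size (selected_indices K S))) => [/size0nil e|d0].
  rewrite (selected_indices_nil_reject fC a1 e) measure0.
  by apply: mule_ge0; rewrite // lee_fin ltW.
pose D i := sign_region (R := R) (i \in S).
have mD i : measurable (D i) by exact: measurable_sign_region.
have mB : measurable (\bigcap_(i in [set` [set: 'I_n]%SET]) p i @^-1` D i).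
  by rewrite -pattern_eventE.
have Bpos : (0 < Q (\bigcap_(i in [set` [set: 'I_n]%SET]) p i @^-1` D i))%E.
  by rewrite -pattern_eventE.
have [indc marg] := mutually_independent_cond mB indp mD Bpos.
have Dpos i : (0 < Q (p i @^-1` D i))%E.
  apply: lt_le_trans Bpos _; apply: le_measure; rewrite ?inE//.
    exact: measurable_funPTI.
  by move=> w; apply; rewrite /= inE.
set Q' := cond_measure Q mB in indc marg.
pose ind := in_tuple (selected_indices K S).
have tinj : injective (tnth ind) by apply/tuple_uniqP; exact: uniq_selected_indices.
have indY : mutually_independent Q' (@selected_variable K S).
  exact: (mutually_independent_comp
    (fun k => clipped (tnth ind k \in S) : {mfun R >-> R}) tinj indc).
have validY (k : 'I_(size (selected_indices K S))) (t : R) : in01 t ->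
    (Q' [set w | (selected_variable k w <= t)%R] <= t%:E)%E.
  (* At [t = 1] the bound is trivial; for [t < 1] the truncation at 1 does not change the event. *)
  move=> t01; have /andP[_ t1] := t01; move: t1; rewrite le_eqVlt => /predU1P[->|t1].
    apply: probability_le1.
    rewrite (_ : [set w | _] = selected_variable k @^-1` `]-oo, 1]%classic).
      by apply: measurable_funPTI; exact: measurable_itv.
    by apply/seteqP; split=> w; rewrite /= in_itv.
  set i := tnth ind k.
  pose C := clipped (i \in S) @^-1` `]-oo, t]%classic.
  have mC : measurable C.
    rewrite -[C]setTI; apply: measurable_clipped => //; exact: measurable_itv.
  have -> : [set w | (selected_variable k w <= t)%R] = p i @^-1` C.
    by apply/seteqP; split=> w; rewrite /= /C /= in_itv.
  rewrite marg// lee_fin.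
  rewrite (_ : p i @^-1` C =
     [set w | (if i \in S then 2 * p i w else 2 * (1 - p i w)) <= t]).
    apply: Qp => //.
    by rewrite -mem_selected_indices; exact: mem_tnth.
  by apply/seteqP; split=> w; rewrite /= /C /= in_itv/= clipped_le.
have a01 : in01 alpha by rewrite /in01 !ltW.
case: (fC) => _ _ vf _.
have := vf _ _ _ Q' (@selected_variable K S) d0
  (@selected_variable_in01 K S) indY validY alpha a01.
set G := [set w | _] => QG.
(* [G] is defined through the clipped variables, which agree with the selected p-values on the
   pattern. *)
have GE : reject f alpha K `&` pattern_event S = G `&` pattern_event S.
  apply/seteqP; split=> w [wr wS]; split=> //; move: wr;
    by rewrite /reject /G /= (selected_tupleE _ wS).
rewrite GE; rewrite pattern_eventE -/D in GE mI *.
have mGB : measurable (G `&` \bigcap_(i in [set` [set: 'I_n]%SET]) p i @^-1` D i).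
  by rewrite -GE.
move: QG; rewrite /Q' cond_measureE// lee_fin /cond_prob.
rewrite ler_pdivrMr; last by rewrite fine_gt0// Bpos ltey_eq fin_num_measure.
by rewrite -lee_fin EFinM !fineK ?fin_num_measure.
Qed.

End SignPatterns.

(** * From acceptance of the true orthant to all bounds *)

Section Coverage.
Context {R : realType} {n : nat}.
Implicit Types (f : seq R -> R) (alpha : R) (theta : 'I_n -> R) (p : 'I_n -> R).

Definition true_orthant theta : {set 'I_n} := [set i | (0 < theta i)%R]%SET.

Lemma card_true_orthantI theta (I : {set 'I_n}) :
  #|true_orthant theta :&: I| = n_plus theta I.
Proof. by apply: eq_card => i; rewrite !inE andbC. Qed.

Lemma card_sign_counts theta (I : {set 'I_n}) :
  #|I| = (n_plus theta I + (n_minus theta I + n_zero theta I))%N.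
Proof.
rewrite -(cardID [pred i | 0 < theta i] I); congr (_ + _)%N.
rewrite -(cardID [pred i | theta i < 0]); congr (_ + _)%N;
  apply: eq_card => i; rewrite !inE; case: (i \in I); rewrite ?andbF//=;
  by case: ltgtP.
Qed.

(** The accepted true orthant puts [n_plus theta I] into [Nplus] for every [I] at once, so this
    count lies between the minimum and the maximum of [Nplus]. *)
Lemma bounds_hold_of_accept f alpha theta p :
  alpha < f (selected_pvalues p (true_orthant theta)) ->
  bounds_hold f alpha theta p.
Proof.
move=> acc I; have leI : (n_plus theta I < #|I|.+1)%N.
  by rewrite ltnS (card_sign_counts theta) leq_addr.
have vN : Ordinal leI \in Nplus f alpha p I.
  rewrite inE; apply/psi_count_eq0; exists (true_orthant theta) => //.
  exact: card_true_orthantI.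
split.
  rewrite /ell_plus -[leqRHS]/(val (Ordinal leI)).
  by apply: (bigminn_le (fun v : 'I_#|I|.+1 => v : nat)); rewrite ?mem_index_enum.
rewrite leq_subLR [leqLHS](card_sign_counts theta) leq_add2r.
exact: (leq_bigmax_cond (F := fun v : 'I_#|I|.+1 => v : nat) (Ordinal leI) vN).
Qed.

Lemma bounds_hold_psi f alpha theta p p' : psi f alpha p =1 psi f alpha p' ->
  bounds_hold f alpha theta p -> bounds_hold f alpha theta p'.
Proof.
by move=> /funext e; rewrite /bounds_hold /ell_plus /ell_minus /Nplus /psi_count e.
Qed.

End Coverage.

(** * Conditional and unconditional coverage *)

Section PatternProbability.
Context {R : realType} {disp : measure_display} {T : measurableType disp}.
Context {n : nat} (P : ('I_n -> R) -> probability T R).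
Variables (p : 'I_n -> {mfun T >-> R}) (theta : 'I_n -> R).
Let Q := P theta.
Let K := true_orthant theta.

(** Unconditional validity at level 1/2 bounds the probability of the wrong side by 1/2. The correct
    side is [p i <= 2^-1] when [theta i] is positive. *)
Lemma correct_sign_ge (i : 'I_n) : valid_pvalues P p ->
  ((2^-1)%:E <= Q (p i @^-1` sign_region (i \in K)))%E.
Proof.
move=> /(_ theta i 2^-1) []; first by apply/andP; split; lra.
have mr b : measurable (p i @^-1` sign_region b).
  by apply: measurable_funPTI; exact: measurable_sign_region.
have compl b : (Q (p i @^-1` sign_region (~~ b)) <= (2^-1)%:E)%E ->
    ((2^-1)%:E <= Q (p i @^-1` sign_region b))%E.
  rewrite (_ : p i @^-1` sign_region (~~ b) = ~` (p i @^-1` sign_region b)).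
    rewrite probability_setC// -[Q (_ @^-1` sign_region b)]fineK ?fin_num_measure//.
    by rewrite -EFinB !lee_fin; lra.
  apply/seteqP; case: b => /=; split=> w /=; rewrite ?ltNge//.
  - by move/negP.
  - by move/negP.
  - by move=> ->.
  - by move/negP; rewrite negbK.
move=> Hm Hp; apply: compl; rewrite inE; case: ltP => ti; last exact: Hm.
(* For positive [theta i] the wrong side [p i > 2^-1] lies in the closed event [1 - p i <= 2^-1]. *)
apply: le_trans (Hp (ltW ti)); apply: le_measure; rewrite ?inE//.
  rewrite (_ : [set w | _] = p i @^-1` `[2^-1, +oo[%classic).
    by apply: measurable_funPTI; exact: measurable_itv.
  by apply/seteqP; split=> w; rewrite /= in_itv/= andbT; lra.
by move=> w /=; lra.
Qed.

Lemma correct_pattern_ge : valid_pvalues P p -> A2 P p ->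
  ((2 ^- n)%:E <= Q (pattern_event p K))%E.
Proof.
move=> vp /(_ theta) indp; rewrite pattern_eventE indp; last first.
  by move=> i; exact: measurable_sign_region.
have fin (i : 'I_n) : (fine (Q (p i @^-1` sign_region (i \in K))))%:E =
    Q (p i @^-1` sign_region (i \in K)).
  rewrite fineK// fin_num_measure//.
  by apply: measurable_funPTI; exact: measurable_sign_region.
under eq_bigr do rewrite -fin.
rewrite prodEFin lee_fin -exprVn -[n in _ ^+ n]card_ord -cardsT -prodr_const.
by apply: ler_prod => i _; rewrite invr_ge0 ler0n/= -lee_fin fin correct_sign_ge.
Qed.

Variables (f : seq R -> R) (alpha : R).
Hypotheses (a01 : 0 < alpha < 1) (p01 : forall i w, in01 (p i w)).
Hypotheses (fC : combining_function f) (pA1 : A1 P p) (pA2 : A2 P p).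

Lemma true_reject_pattern S :
  (Q (reject p f alpha K `&` pattern_event p S) <=
   alpha%:E * Q (pattern_event p S))%E.
Proof.
apply: (reject_pattern p01 fC a01 (pA2 theta)) => i t; rewrite inE.
case: (boolP (i \in S)) => iS; rewrite ?addbT ?addbF => ti t01 Dpos.
  by have [+ _] := pA1 theta i t01; apply; rewrite // leNgt.
by have [_] := pA1 theta i t01; apply; rewrite // ltW.
Qed.

(** Over the sign patterns, [S = K] contributes 0, and the others at most [alpha] times their total
    mass, which is at most [1 - 2 ^- n]. *)
Lemma true_reject_le : valid_pvalues P p ->
  (Q (reject p f alpha K) <= ((1 - 2 ^- n) * alpha)%:E)%E.
Proof.
move=> vp; have /andP[a0 a1] := a01.
have mr := measurable_reject p01 K fC a1.
have mB S : measurable (pattern_event p S) by exact: measurable_pattern_event.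
have tB : trivIset setT (pattern_event p) by exact: trivIset_pattern_event.
have cB := bigcup_pattern_event p.
rewrite (measure_finite_partition Q mr mB tB cB) (bigD1 K)//=.
rewrite (selected_indices_nil_reject p01 fC a1 (selected_indices_id K)).
rewrite measure0 add0e.
have fin S : Q (pattern_event p S) = (fine (Q (pattern_event p S)))%:E.
  by rewrite fineK// fin_num_measure.
have : (\sum_(S | S != K) Q (reject p f alpha K `&` pattern_event p S) <=
    \sum_(S | S != K) alpha%:E * Q (pattern_event p S))%E.
  by apply: lee_sum => S _; exact: true_reject_pattern.
move/le_trans; apply.
under eq_bigr do rewrite fin -EFinM.
rewrite sumEFin lee_fin -mulr_sumr mulrC ler_pM2r//.
have := measure_finite_partition Q measurableT mB tB cB.
rewrite probability_setT (bigD1 K)//=.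
under eq_bigr do rewrite setTI fin.
rewrite setTI fin sumEFin -EFinD => -[one].
have := correct_pattern_ge vp pA2; rewrite fin lee_fin; lra.
Qed.

Definition coverage_event : set T :=
  [set w | bounds_hold f alpha theta (fun i => p i w)].

Lemma measurable_coverage_event : measurable coverage_event.
Proof.
have /andP[a0 a1] := a01.
apply: (measurable_finite_pattern (A := reject p f alpha)).
  by move=> S; exact: measurable_reject.
(* The bounds depend on the p-values only through the finitely many tests [psi]. *)
move=> w w' ww'; apply: bounds_hold_psi => S.
by rewrite /psi; congr nat_of_bool; apply/idP/idP; apply ww'.
Qed.

Lemma accept_sub_coverage : ~` reject p f alpha K `<=` coverage_event.
Proof. by move=> w /negP; rewrite -ltNge; exact: bounds_hold_of_accept. Qed.

Lemma coverage_ge : valid_pvalues P p ->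
  ((1 - (1 - 2 ^- n) * alpha)%:E <= Q coverage_event)%E.
Proof.
move=> vp; have /andP[a0 a1] := a01.
have mr := measurable_reject p01 K fC a1.
apply: (@le_trans _ _ (Q (~` reject p f alpha K))).
  rewrite probability_setC// EFinB; apply: leeB => //.
  exact: true_reject_le.
apply: le_measure; rewrite ?inE.
- exact: measurableC.
- exact: measurable_coverage_event.
exact: accept_sub_coverage.
Qed.

Lemma coverage_cond_ge S : (0 < Q (pattern_event p S))%E ->
  1 - alpha <= cond_prob Q coverage_event (pattern_event p S).
Proof.
move=> Spos; have /andP[a0 a1] := a01.
have mr := measurable_reject p01 K fC a1.
have mS := measurable_pattern_event p S.
have mE := measurable_coverage_event.
rewrite /cond_prob ler_pdivlMr; last first.
  by rewrite fine_gt0// Spos ltey_eq fin_num_measure.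
rewrite -lee_fin EFinM !fineK ?fin_num_measure//; last exact: measurableI.
apply: (@le_trans _ _ (Q (pattern_event p S `\` reject p f alpha K))); last first.
  apply: le_measure; rewrite ?inE; [exact: measurableD|exact: measurableI|].
  by move=> w [wS wr]; split=> //; exact: accept_sub_coverage.
rewrite measureD//; last by rewrite ltey_eq fin_num_measure.
rewrite EFinB muleBl// ?fin_num_measure// mul1e.
by apply: leeB => //; rewrite setIC; exact: true_reject_pattern.
Qed.

End PatternProbability.

Theorem proposition4p2 (R : realType) :
  (exists (C : nat)
     (alg : forall n : nat, R -> {set 'I_n} -> ('I_n -> R) ->
              oracle_prog R (nat * nat)),
     forall (n : nat) (alpha : R) (I : {set 'I_n}) (p : 'I_n -> R)
       (f : seq R -> R),
     0 < alpha < 1 -> I != finset.set0 -> (forall i, in01 (p i)) ->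
     combining_function f -> A0 f ->
     let r := run f (alg n alpha I p) in
     r.1 = (ell_plus f alpha p I, ell_minus f alpha p I) /\
     (r.2 <= C * (#|I| ^ 2 * maxn 1 (#|~: I| ^ 2)))%N)
  /\
  (forall (n : nat) (alpha : R) (disp : measure_display)
     (T : measurableType disp) (P : ('I_n -> R) -> probability T R)
     (p : 'I_n -> {mfun T >-> R}) (f : seq R -> R),
     0 < alpha < 1 -> (forall i w, in01 (p i w)) -> valid_pvalues P p ->
     combining_function f -> A0 f -> A1 P p -> A2 P p ->
     forall theta : 'I_n -> R,
     let E := [set w | bounds_hold f alpha theta (fun i => p i w)] in
     (forall s : {ffun 'I_n -> int},
        let Bs := [set w | signs (fun i => p i w) = s] in
        (0 < P theta Bs)%E -> 1 - alpha <= cond_prob (P theta) E Bs) /\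
     (((1 - (1 - 2 ^- n) * alpha)%:E <= P theta E)%E /\
      1 - (1 - 2 ^- n) * alpha > 1 - alpha)).
Proof.
split.
  exists 16%N, (@bounds_prog R) => n alpha I p f _ I0 p01 _ fA0 /=.
  rewrite bounds_prog_correct//; split=> //=.
  by rewrite size_candidates candidate_count_bound// card_gt0.
move=> n alpha disp T P p f a01 p01 vp fC _ pA1 pA2 theta E; split; last first.
  split; first exact: coverage_ge.
  have /andP[a0 _] := a01.
  by rewrite ltrD2l ltrN2 -[ltRHS]mul1r ltr_pM2r// gtrBl.
move=> s Bs Bpos.
(* A sign vector of positive probability is realized at some [w], whose set [Sminus] names the
   corresponding pattern event. *)
have [w ws] : Bs !=set0.
  by apply/set0P/eqP => e; move: Bpos; rewrite e measure0 ltxx.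
rewrite /Bs/= in ws.
suff BsE : Bs = pattern_event p (Sminus (fun i => p i w)).
  by rewrite BsE; apply: coverage_cond_ge => //; rewrite -BsE.
apply/seteqP; split=> w' /= e.
  apply/setP => i; rewrite !inE.
  have : signs (fun i => p i w') i = signs (fun i => p i w) i by rewrite e -ws.
  by rewrite !ffunE; case: (p i w' <= _); case: (p i w <= _).
rewrite /Bs/= -ws; apply/ffunP => i; rewrite !ffunE.
by have /setP/(_ i) := e; rewrite !inE => ->.
Qed.
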